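(* Let $G$ be a paratopological group and let $A$ and $B$ be $\omega$-narrow subsets of $G$. Then $AB=\{ab : a\in A,\ b\in B\}$ is $\omega$-narrow in $G$.
   Context: All spaces are assumed to be $T_1$ and regular. A paratopological group is a group $G$ with a topology such that the multiplication map $G\times G\to G$ is jointly continuous (the inverse map need not be continuous). A subset $B$ of a paratopological group $G$ is called $\omega$-narrow in $G$ if for each neighborhood $U$ of the identity in $G$ there is a countable subset $F$ of $G$ such that $B\subset FU\cap UF$. *)

(* Defs.v *)
From HB Require Import structures.
From mathcomp Require Import all_boot.
From mathcomp Require Import boolp classical_sets functions cardinality.
From mathcomp Require Import topology.

Set Implicit Arguments.
Unset Strict Implicit.
Unset Printing Implicit Defensive.

Local Open Scope classical_set_scope.
Local Open Scope group_scope.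

HB.structure Definition PreTopologicalGroup :=
  {G of Topological G & Group G}.

HB.mixin Record PreTopologicalGroup_isParatopological G
    & PreTopologicalGroup G := {
  mulg_continuous : continuous (fun x : G * G => x.1 * x.2)
}.

(* Inversion is not required to be continuous, and no separation axiom is
   part of the structure. *)
#[short(type="paratopologicalGroupType")]
HB.structure Definition ParatopologicalGroup :=
  {G of PreTopologicalGroup G & PreTopologicalGroup_isParatopological G}.

Definition set_mulg (G : magmaType) (A B : set G) : set G :=
  [set a * b | a in A & b in B].

Definition omega_narrow (G : paratopologicalGroupType) (B : set G) : Prop :=
  forall U : set G, nbhs 1 U ->
    exists F : set G,
      countable F /\ B `<=` set_mulg F U `&` set_mulg U F.

(* Main.v *)
Require Import Defs.
From HB Require Import structures.
From mathcomp Require Import all_boot.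
From mathcomp Require Import boolp classical_sets functions cardinality.
From mathcomp Require Import topology.

(** Given a neighborhood [U] of the identity, take a neighborhood [V] of the
    identity with [V V] inside [U] ([nbhs1_square]).  For the left covers, let
    [F] be countable with [B] inside [F V].  Then [A B] lies in the union of the
    sets [A f V], [f] in [F].  Each conjugate [f V f^-1] is again a neighborhood
    of the identity, because translations are continuous ([nbhs1_conjg]), so
    [A] lies in [F_f (f V f^-1)] for some countable [F_f].  Hence
    [A f] lies in [F_f f V], and [A f V] lies in [F_f f V V], inside
    [(F_f f) U].  The union of the sets [F_f f] over [f] in [F] is countable.
    The right covers are obtained in the mirror-image way, starting from a cover
    of [A] by [V F] and then covering [B] by translates of the conjugates
    [f^-1 V f]. *)

Local Open Scope classical_set_scope.
Local Open Scope group_scope.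

Lemma nbhs1_square (G : paratopologicalGroupType) (U : set G) :
  nbhs 1 U -> exists2 V : set G, nbhs 1 V & set_mulg V V `<=` U.
Proof.
move=> nU.
have : nbhs ((1, 1) : G * G) [set x | U (x.1 * x.2)].
  by apply: (mulg_continuous (1, 1)); rewrite /= mulg1.
case=> -[V1 V2] /= [nV1 nV2] sub.
exists (V1 `&` V2); first exact: filterI.
by move=> _ [x [V1x _] [y [_ V2y] <-]]; exact: (sub (x, y)).
Qed.

Lemma lmulg_continuous (G : paratopologicalGroupType) (g : G) :
  continuous (fun x : G => g * x).
Proof.
move=> x.
have pg : {for x, continuous (fun y : G => (g, y))}.
  by apply: cvg_pair; [exact: cvg_cst | exact: cvg_id].
exact: (continuous_comp pg (mulg_continuous (g, x))).
Qed.

Lemma rmulg_continuous (G : paratopologicalGroupType) (g : G) :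
  continuous (fun x : G => x * g).
Proof.
move=> x.
have pg : {for x, continuous (fun y : G => (y, g))}.
  by apply: cvg_pair; [exact: cvg_id | exact: cvg_cst].
exact: (continuous_comp pg (mulg_continuous (x, g))).
Qed.

(** The set in the conclusion is the conjugate [g V g^-1], written as a preimage
    so that continuity of translations applies directly. *)
Lemma nbhs1_conjg (G : paratopologicalGroupType) (g : G) (V : set G) :
  nbhs 1 V -> nbhs 1 [set x | V (g^-1 * x * g)].
Proof.
move=> nV.
have c : {for 1, continuous (fun x : G => g^-1 * x * g)} :=
  continuous_comp (@lmulg_continuous _ g^-1 1) (@rmulg_continuous _ g _).
by apply: c; rewrite mulg1 mulVg.
Qed.

(** For a binary operation [m] equal to the product in either order, this gives
    countability of the sets of translating elements [F_f f] or [f F_f]. *)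
Lemma countable_bigcup_image2 (T : Type) (m : T -> T -> T) (F : set T)
    (E : T -> set T) :
  countable F -> (forall f, countable (E f)) ->
  countable (\bigcup_(f in F) (m f @` E f)).
Proof.
move=> cF cE; apply: bigcup_countable => // f _.
exact: card_le_trans (card_image_le _ _) (cE f).
Qed.

Lemma left_cover_set_mulg (G : paratopologicalGroupType) (A B U : set G) :
  omega_narrow A -> omega_narrow B -> nbhs 1 U ->
  exists2 F : set G, countable F & set_mulg A B `<=` set_mulg F U.
Proof.
move=> nA nB /nbhs1_square[V nV VVU].
have [F [cF BF]] := nB _ nV.
have /choice[E EP] f := nA _ (nbhs1_conjg _ f _ nV).
exists (\bigcup_(f in F) ((fun e => e * f) @` E f)).
  apply: (@countable_bigcup_image2 _ (fun f e => e * f)) => // f.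
  by have [] := EP f.
move=> _ [a Aa [b Bb <-]].
have [[f Ff [v Vv <-]] _] := BF _ Bb.
have [_ /(_ _ Aa)[[e Ee [w Vw <-]] _]] := EP f.
exists (e * f); first by exists f => //; exists e.
(* [e w f v = (e f) (f^-1 w f) v], with both last factors in [V] *)
exists (f^-1 * w * f * v).
  by apply: VVU; exists (f^-1 * w * f) => //; exists v.
by rewrite !mulgA mulgK.
Qed.

Lemma right_cover_set_mulg (G : paratopologicalGroupType) (A B U : set G) :
  omega_narrow A -> omega_narrow B -> nbhs 1 U ->
  exists2 F : set G, countable F & set_mulg A B `<=` set_mulg U F.
Proof.
move=> nA nB /nbhs1_square[V nV VVU].
have [F [cF AF]] := nA _ nV.
have /choice[E EP] f := nB _ (nbhs1_conjg _ f^-1 _ nV).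
exists (\bigcup_(f in F) ((fun e => f * e) @` E f)).
  apply: (@countable_bigcup_image2 _ (fun f e => f * e)) => // f.
  by have [] := EP f.
move=> _ [a Aa [b Bb <-]].
have [_ [v Vv [f Ff <-]]] := AF _ Aa.
have [_ /(_ _ Bb)[_ [w /= Vw [e Ee <-]]]] := EP f.
rewrite invgK in Vw.
(* [v f w e = v (f w f^-1) (f e)], with both first factors in [V] *)
exists (v * (f * w * f^-1)).
  by apply: VVU; exists v => //; exists (f * w * f^-1).
exists (f * e); first by exists f => //; exists e.
by rewrite !mulgA mulgVK.
Qed.

Lemma countable_setU (T : Type) (E F : set T) :
  countable E -> countable F -> countable (E `|` F).
Proof.
by move=> cE cF; rewrite -bigcup2E; apply: bigcup_countable => // -[|[|n]] _ /=.
Qed.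

(** A single countable set must serve on both sides; the union of the two
    one-sided covers does. *)
Theorem theorem3p2 (G : paratopologicalGroupType) (A B : set G)
  (hT1 : accessible_space G) (hreg : regular_space G)
  (hA : omega_narrow A) (hB : omega_narrow B) :
  omega_narrow (set_mulg A B).
Proof.
move=> U nU.
have [F cF ABF] := left_cover_set_mulg G A B U hA hB nU.
have [E cE ABE] := right_cover_set_mulg G A B U hA hB nU.
exists (F `|` E); split; first exact: countable_setU.
move=> x ABx; split.
- by have [f Ff [u Uu <-]] := ABF _ ABx; exists f; [left | exists u].
- by have [u Uu [e Ee <-]] := ABE _ ABx; exists u => //; exists e; [right |].
Qed.
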